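(* Let $I\subset\mathbb{R}$ be a nondegenerate interval, let $n\in\mathbb{N}$, let $\omega=(\omega_1,\dots,\omega_n):I\to\mathbb{R}^n$ be an $n$-dimensional positive Chebyshev system over $I$, and let $\omega_{n+1}:I\to\mathbb{R}$ be such that $\omega^*=(\omega_1,\dots,\omega_n,\omega_{n+1})$ is an $(n+1)$-dimensional positive Chebyshev system over $I$. A function $f:I\to\mathbb{R}$ is $\omega$-convex on $I$ if and only if, for all $p\in I$, there exists a neighborhood $U$ of $p$ (in $I$) such that $f$ is $\omega$-convex on $U$.
   Context: $\mathbb{N}$ is the set of positive integers. $\sigma_k(S):=\{(x_1,\dots,x_k)\in S^k\mid x_1<\dots<x_k\}$ for $S\subseteq\mathbb{R}$. For $\omega=(\omega_1,\dots,\omega_k):I\to\mathbb{R}^k$ and $(x_1,\dots,x_k)\in\sigma_k(I)$, $\Phi_\omega(x_1,\dots,x_k):=\det\big(\omega_i(x_j)\big)_{i,j=1}^k$. $\omega$ is a $k$-dimensional positive Chebyshev system over $I$ if $\Phi_\omega>0$ on $\sigma_k(I)$. For an $n$-dimensional $\omega$ and $f:I\to\mathbb{R}$, $(\omega,f):=(\omega_1,\dots,\omega_n,f)$. $f$ is $\omega$-convex on a set $S\subseteq I$ if $\Phi_{(\omega,f)}\ge0$ on $\sigma_{n+1}(S)$. (The auxiliary function $\omega_{n+1}$ is part of the paper's standing setting; it does not enter the equivalence.) *)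

(* Defs.v *)
From mathcomp Require Import all_boot all_order all_algebra.
From mathcomp Require Import all_classical all_reals all_analysis.

Set Implicit Arguments.
Unset Strict Implicit.
Unset Printing Implicit Defensive.

Import Order.TTheory GRing.Theory Num.Theory.
Import numFieldNormedType.Exports.

Local Open Scope classical_set_scope.
Local Open Scope ring_scope.

(* A function on a set S of reals is given by a
   total function on R; the definitions below only look at its values on S. *)

Definition sigma (R : realType) (k : nat) (S : set R) : set 'rV[R]_k :=
  [set x | (forall i, S (x 0 i)) /\
           (forall i j : 'I_k, (i < j)%N -> x 0 i < x 0 j)].

Definition Phi (R : realType) (k : nat) (omega : R -> 'rV[R]_k)
    (x : 'rV[R]_k) : R :=
  \det (\matrix_(i < k, j < k) omega (x 0 j) 0 i).

Definition positive_Chebyshev_system (R : realType) (k : nat) (I : set R)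
    (omega : R -> 'rV[R]_k) : Prop :=
  forall x, sigma I x -> 0 < Phi omega x.

(* (omega_1, ..., omega_n, f); the scalar f t is the 1 x 1 last block. *)
Definition adjoin (R : realType) (n : nat) (omega : R -> 'rV[R]_n)
    (f : R -> R) : R -> 'rV[R]_(n + 1) :=
  fun t => row_mx (omega t) (f t)%:M.

Definition omega_convex (R : realType) (n : nat) (omega : R -> 'rV[R]_n)
    (S : set R) (f : R -> R) : Prop :=
  forall x, sigma S x -> 0 <= Phi (adjoin omega f) x.

(* Main.v *)
(* Only the local-to-global direction has content. Take n + 1 points of I and
   choose e > 0 such that f is omega-convex on every interval of length e
   starting between the extreme points (compactness). Subdivide so finely that
   any n + 1 consecutive points of the subdivision lie in such an interval.
   The sign then passes from consecutive (n + 1)-tuples to arbitrary ones by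
   induction on their spread: inserting a subdivision point into a tuple with a
   gap gives n + 2 points, and the determinant of the original tuple is
   nonnegative as soon as those obtained by deleting the first and the last
   point are. *)
Require Import Defs.
From mathcomp Require Import all_boot all_order all_algebra.
From mathcomp Require Import all_classical all_reals all_analysis.
From mathcomp Require Import lra zify.

Set Implicit Arguments.
Unset Strict Implicit.
Unset Printing Implicit Defensive.

Import Order.TTheory GRing.Theory Num.Theory.
Import numFieldNormedType.Exports.

Local Open Scope classical_set_scope.
Local Open Scope ring_scope.

(** * Collocation determinants and their sign under point insertion *)

(** The points form a sequence on all of [nat], of which only the first [n] matter. Deleting the
    [j]-th point is then composition with [bump j], with no ordinal casts. *)
Definition colloc_det (R : comPzRingType) (T : Type) (n : nat)
    (w : 'I_n -> T -> R) (x : nat -> T) : R :=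
  \det (\matrix_(i < n, j < n) w i (x j)).

Definition border (R : Type) (T : Type) (n : nat)
    (w : 'I_n -> T -> R) (h : T -> R) : 'I_n.+1 -> T -> R :=
  fun i => if unlift ord_max i is Some i' then w i' else h.

Lemma eq_colloc_det (R : comPzRingType) (T : Type) (n : nat)
    (w : 'I_n -> T -> R) (x y : nat -> T) :
  (forall j, (j < n)%N -> x j = y j) -> colloc_det w x = colloc_det w y.
Proof. by move=> xy; congr (\det _); apply/matrixP => i j; rewrite !mxE xy. Qed.

Lemma colloc_det_border (R : comPzRingType) (T : Type) (n : nat)
    (w : 'I_n -> T -> R) (h : T -> R) (x : nat -> T) :
  colloc_det (border w h) x =
  \sum_(j < n.+1) h (x j) * ((-1) ^+ (n + j) * colloc_det w (x \o bump j)).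
Proof.
rewrite /colloc_det (expand_det_row _ ord_max); apply: eq_bigr => j _.
rewrite mxE /border unlift_none /cofactor; congr (_ * (_ * \det _)).
by apply/matrixP => i k; rewrite !mxE liftK.
Qed.

Lemma colloc_det_border_row (R : comPzRingType) (T : Type) (n : nat)
    (w : 'I_n -> T -> R) (i : 'I_n) (x : nat -> T) :
  colloc_det (border w (w i)) x = 0.
Proof.
rewrite /colloc_det (determinant_alternate (neq_lift ord_max i)) // => j.
by rewrite !mxE /border unlift_none liftK.
Qed.

(** The expansion along the last row is linear in [h], and it vanishes at [h = w i] because two rows
    coincide. *)
Lemma colloc_det_borderB (R : comPzRingType) (T : Type) (n : nat)
    (w : 'I_n -> T -> R) (h : T -> R) (c : 'I_n -> R) (x : nat -> T) :
  colloc_det (border w (fun t => h t - \sum_i c i * w i t)) x =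
  colloc_det (border w h) x.
Proof.
rewrite !colloc_det_border.
under eq_bigr do rewrite mulrBl mulr_suml.
rewrite big_split /= sumrN exchange_big /= [X in _ - X]big1 ?subr0 // => i _.
under eq_bigr do rewrite -mulrA.
by rewrite -mulr_sumr -colloc_det_border colloc_det_border_row mulr0.
Qed.

Lemma colloc_det_interpolation (F : fieldType) (T : Type) (n : nat)
    (w : 'I_n -> T -> F) (h : T -> F) (x : nat -> T) :
  colloc_det w x != 0 ->
  exists c : 'I_n -> F, forall k, (k < n)%N -> h (x k) = \sum_i c i * w i (x k).
Proof.
move=> x_neq0; pose W := \matrix_(i < n, j < n) w i (x j).
have W_unit : W \in unitmx by rewrite unitmxE unitfE.
exists (fun i => (\row_j h (x j) *m invmx W) 0 i) => k ltkn.
have /rowP/(_ (Ordinal ltkn)) := mulmxKV W_unit (\row_j h (x j)).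
rewrite mxE [X in _ = X]mxE => <-; apply: eq_bigr => i _.
by rewrite [W _ _]mxE.
Qed.

(* Subtracting from [h] its [w]-interpolant at the [n] inner points changes
   none of the determinants; only the values of [h] at the two extreme points
   remain, and the determinants omitting one of these fix their signs. *)
Lemma colloc_det_border_insert (R : realFieldType) (T : Type) (n : nat)
    (w : 'I_n -> T -> R) (h : T -> R) (x : nat -> T) (k : nat) :
  (0 < k <= n)%N ->
  (forall y : nat -> nat, {homo y : i j / (i < j)%N} ->
     (forall j, (j < n)%N -> (y j < n.+2)%N) -> 0 < colloc_det w (x \o y)) ->
  0 <= colloc_det (border w h) (x \o bump 0%N) ->
  0 <= colloc_det (border w h) (x \o bump n.+1) ->
  0 <= colloc_det (border w h) (x \o bump k).
Proof.
move=> /andP[k_gt0 lekn] w_gt0.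
have bump_homo i : {homo bump i : a b / (a < b)%N}.
  by move=> a b; rewrite /bump; lia.
have w2_gt0 i j : 0 < colloc_det w (x \o bump i \o bump j).
  apply: (w_gt0 (bump i \o bump j)) => [a b ltab|a ltan].
    exact/bump_homo/bump_homo.
  by rewrite /bump /=; lia.
have inner_gt0 : 0 < colloc_det w (x \o succn).
  by apply: (w_gt0 succn) => // j /ltnW.
have [c hc] := colloc_det_interpolation h (lt0r_neq0 inner_gt0).
rewrite -!(colloc_det_borderB w h c); set g := fun t => _.
have g0 i : (0 < i <= n)%N -> g (x i) = 0.
  by case: i => // i ltin; rewrite /g hc ?subrr.
have n_gt0 : (0 < n)%N := leq_trans k_gt0 lekn.
have signrnn : (-1) ^+ (n + n) = 1 :> R by rewrite -signr_odd oddD addbb.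
(* The residual [g] vanishes at [x 1], ..., [x n], so only the first and last positions contribute.
   The last position holds [x n.+1] if [i <= n], and [x n] if [i = n.+1]. *)
have ends i : (0 < i)%N -> colloc_det (border w g) (x \o bump i) =
    g (x 0%N) * ((-1) ^+ n * colloc_det w (x \o bump i \o bump 0%N)) +
    g (x (bump i n)) * colloc_det w (x \o bump i \o bump n).
  move=> i_gt0; have b0 : bump i 0%N = 0%N by rewrite /bump; lia.
  have max_neq0 : ord_max != ord0 :> 'I_n.+1 by rewrite -val_eqE /= -lt0n.
  rewrite colloc_det_border (bigD1 ord0) //= (bigD1 ord_max) //= b0 addn0.
  rewrite big1 ?addr0 => [|j]; last first.
    rewrite -!val_eqE /= => /andP[j_neq0 j_neqn]; rewrite g0 ?mul0r //.
    by have := ltn_ord j; rewrite /bump; lia.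
  by rewrite signrnn mul1r.
have first : colloc_det (border w g) (x \o bump 0%N) =
    g (x n.+1) * colloc_det w (x \o succn).
  rewrite colloc_det_border big_ord_recr /= big1 ?add0r => [|j _].
    rewrite signrnn mul1r; congr (g (x _) * _).
    by apply: eq_colloc_det => j ltjn /=; congr x; rewrite /bump; lia.
  by rewrite g0 ?mul0r //= /bump; have := ltn_ord j; lia.
have last : colloc_det (border w g) (x \o bump n.+1) =
    g (x 0%N) * ((-1) ^+ n * colloc_det w (x \o succn)).
  have bn : bump n.+1 n = n by rewrite /bump ltnn.
  rewrite ends // bn (g0 n) ?n_gt0 ?leqnn // mul0r addr0.
  congr (_ * (_ * _)); apply: eq_colloc_det => j ltjn /=.
  by congr x; rewrite /bump; lia.
rewrite first last mulrCA => gn0 g00.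
have {}gn0 : 0 <= g (x n.+1) by move: gn0; rewrite pmulr_lge0.
have {}g00 : 0 <= (-1) ^+ n * g (x 0%N).
  by move: g00; rewrite mulrA pmulr_lge0.
rewrite ends // [bump k n]/bump lekn.
have -> : g (x 0%N) * ((-1) ^+ n * colloc_det w (x \o bump k \o bump 0%N)) =
    ((-1) ^+ n * g (x 0%N)) * colloc_det w (x \o bump k \o bump 0%N).
  by rewrite mulrCA mulrA.
by rewrite addr_ge0 // mulr_ge0 // ltW.
Qed.

Lemma colloc_det_border_consecutive (R : realFieldType) (T : Type) (n : nat)
    (w : 'I_n -> T -> R) (h : T -> R) (g : nat -> T) (N : nat) :
  (forall y : nat -> nat, {homo y : i j / (i < j)%N} ->
     (forall j, (j < n)%N -> (y j <= N)%N) -> 0 < colloc_det w (g \o y)) ->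
  (forall p, (p + n <= N)%N ->
     0 <= colloc_det (border w h) (g \o addn p)) ->
  forall k : nat -> nat, {homo k : i j / (i < j)%N} -> (k n <= N)%N ->
    0 <= colloc_det (border w h) (g \o k).
Proof.
move=> w_gt0 consec k.
(* Strong induction on the spread. A tuple without gaps is a block of consecutive indices, settled
   by [consec]. *)
have [m] := ubnP (k n - k 0%N); elim: m k => // m IHm k ltm k_homo knN.
have [/existsP[i gap]|] := boolP [exists i : 'I_n, (k i).+1 < k i.+1]%N;
  last first.
  rewrite negb_exists => /forallP nogap.
  have kE j : (j <= n)%N -> k j = (k 0%N + j)%N.
    elim: j => [|j IHj] ltjn; first by rewrite addn0.
    have := nogap (Ordinal ltjn); have := k_homo _ _ (ltnSn j).
    by rewrite /= IHj ?(ltnW ltjn) //; lia.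
  rewrite (@eq_colloc_det _ _ _ _ _ (g \o addn (k 0%N))) => [|j lejn].
    by apply: consec; rewrite -kE.
  by rewrite /= kE.
(* [l] is [k] with the index [(k i).+1] inserted into the gap after position [i], so
   [l \o bump i.+1] gives back [k]. *)
pose l j := if (j <= i)%N then k j else if j == i.+1 then (k i).+1 else k j.-1.
have ltin := ltn_ord i.
have l_homo : {homo l : a b / (a < b)%N}.
  apply: homo_ltn => [? ? ?|a]; first exact: ltn_trans.
  rewrite /l; case: (ltngtP a i) => [lt_ai|lt_ia|->].
  - by rewrite k_homo.
  - rewrite eqSS (gtn_eqF lt_ia) /=; case: (a =P i.+1) => [->|neq] //=.
    by apply: k_homo; lia.
  - by rewrite eqxx.
have bump_homo b : {homo bump b : i j / (i < j)%N}.
  by move=> ? ?; rewrite /bump; lia.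
have lnS : l n.+1 = k n by rewrite /l ifF ?ifF //; lia.
have l0 : l 0%N = k 0%N by rewrite /l.
rewrite (@eq_colloc_det _ _ _ _ _ ((g \o l) \o bump i.+1)); last first.
  move=> j _; rewrite /= /l /bump; case: (ltnP i j) => [ltij|leji].
    by rewrite !ifF //; lia.
  by rewrite add0n leji.
apply: colloc_det_border_insert => //.
- move=> y y_homo y_lt; apply: (w_gt0 (l \o y)) => [a b ltab|j ltjn].
    exact/l_homo/y_homo.
  rewrite (leq_trans _ knN) // -lnS /=.
  by rewrite (ltnW_homo l_homo) // -ltnS y_lt.
(* The inserted index lies strictly between [k 0] and [k n], so deleting either extreme index of [l]
   lowers the spread. *)
- apply: (IHm (l \o bump 0%N)) => [|a b ltab|] /=.
  + rewrite /bump !leq0n !add1n lnS.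
    by have := l_homo 0%N 1%N isT; have := l_homo 0%N n.+1 isT; lia.
  + exact/l_homo/bump_homo.
  + by rewrite /bump leq0n add1n lnS.
- have bn : bump n.+1 n = n by rewrite /bump ltnn.
  have := l_homo _ _ (ltnSn n); rewrite lnS => ltl.
  apply: (IHm (l \o bump n.+1)) => [|a b ltab|].
  + rewrite /= bn /bump ltn0 add0n l0.
    by have := k_homo 0%N n (leq_ltn_trans (leq0n i) ltin); lia.
  + exact/l_homo/bump_homo.
  + by rewrite /= bn; lia.
Qed.

(** * Fine subdivisions and compactness *)

(** Each interval between neighbouring [x j] is cut into [M] equal pieces. All pieces have length at
    most [L / M], and [M] is chosen so that [n] of them span at most [e]. *)
Lemma exists_fine_subdivision (R : realType) (n : nat) (x : nat -> R) (e : R) :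
  (forall i j, (i < j <= n)%N -> x i < x j) -> 0 < e ->
  exists M : nat, exists g : nat -> R,
    [/\ (0 < M)%N,
        {homo g : i j / (i < j)%N >-> i < j},
        forall j, (j <= n)%N -> g (j * M)%N = x j &
        forall p, (p + n <= n * M)%N -> g (p + n)%N <= g p + e].
Proof.
move=> x_incr e_gt0; set L := x n - x 0%N.
have x_mono i j : (i <= j <= n)%N -> x i <= x j.
  move=> /andP[]; rewrite leq_eqVlt => /predU1P[->//|ltij] lejn.
  by rewrite ltW // x_incr ?ltij.
pose M := (Num.trunc (n%:R * L / e)).+1.
have M_gt0 : 0 < M%:R :> R by rewrite ltr0n.
have leM : n%:R * (L / M%:R) <= e.
  rewrite mulrA ler_pdivrMr // [e * _]mulrC -ler_pdivrMr //.
  by rewrite ltW // truncnS_gt.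
(* The default gap 1 beyond [x n] keeps [g] strictly increasing on all of [nat]. *)
pose d j := if (j < n)%N then x j.+1 - x j else 1.
have d_gt0 j : 0 < d j.
  by rewrite /d; case: ifP => // ltjn; rewrite subr_gt0 x_incr // ltnSn.
have d_le j : (j < n)%N -> d j <= L.
  by move=> ltjn; rewrite /d ltjn lerB // x_mono //; lia.
pose g p := x 0%N + \sum_(q < p) d (q %/ M)%N / M%:R.
have gS p : g p.+1 = g p + d (p %/ M)%N / M%:R.
  by rewrite /g big_ord_recr addrA.
exists M, g; split=> //.
- apply: homo_ltn => [? ? ?|p]; first exact: lt_trans.
  by rewrite gS ltrDl divr_gt0.
- have g_block j r : (r <= M)%N ->
      g (j * M + r)%N = g (j * M)%N + r%:R * (d j / M%:R).
    elim: r => [|r IHr] ltrM; first by rewrite addn0 mul0r addr0.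
    rewrite addnS gS IHr ?(ltnW ltrM) // divnMDl // divn_small // addn0.
    by rewrite -addrA -[r.+1]addn1 natrD mulrDl mul1r.
  elim=> [|j IHj] ltjn; first by rewrite /g big_ord0 addr0.
  rewrite mulSn addnC g_block // IHj ?(ltnW ltjn) // /d ltjn.
  by rewrite mulrC divfK ?gt_eqF // addrC subrK.
- have g_le p r : (p + r <= n * M)%N -> g (p + r)%N <= g p + r%:R * (L / M%:R).
    elim: r => [|r IHr] lepr; first by rewrite addn0 mul0r addr0.
    rewrite addnS gS -[r.+1]addn1 natrD mulrDl mul1r addrA lerD //.
      by rewrite IHr // ltnW // -addnS.
    by rewrite ler_pM2r ?invr_gt0 // d_le // ltn_divLR // -addnS.
  by move=> p lep; rewrite (le_trans (g_le _ _ lep)) // lerD2l.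
Qed.

(** A Lebesgue number argument: near each [p] the property holds for all [t] close to [p] and all
    small [e], and compactness of the segment yields one [e] for every [t]. *)
Lemma uniformly_local (R : realType) (I : set R) (P : set R -> Prop) (a b : R) :
  (forall A B, A `<=` B -> P B -> P A) ->
  (forall p, I p -> exists U, within I (nbhs p) U /\ P U) ->
  `[a, b] `<=` I ->
  exists e : R, 0 < e /\ forall t, `[a, b]%classic t -> P (I `&` `[t, t + e]).
Proof.
move=> P_sub P_loc abI.
have cov : near_covering `[a, b]%classic.
  exact/compact_near_coveringP/segment_compact.
have {}cov : \forall e \near 0^'+,
    `[a, b] `<=` (fun t => P (I `&` `[t, t + e])).
  apply: cov => p /abI/P_loc[U [/nbhs_ballP[r /= r_gt0 rU] PU]].
  (* Half of [r] bounds the distance from [p] to [t], the other half the length [e]; hence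
     [[t, t + e]] stays in the ball of radius [r]. *)
  exists (ball p (r / 2), [set e : R | e < r / 2]) => /=.
    split; first by apply: nbhsx_ballx; rewrite divr_gt0.
    by apply: nbhs_right_lt; rewrite divr_gt0.
  move=> [t e] /= [ptr er]; apply: P_sub PU => y [Iy].
  rewrite /= in_itv /= => /andP[ty yte]; apply: rU Iy => //.
  move: ptr; rewrite /ball /= !ltr_norml => /andP[? ?]; apply/andP.
  by split; lra.
have [e [e_gt0 eP]] : exists e : R, 0 < e /\
    `[a, b] `<=` (fun t => P (I `&` `[t, t + e])).
  near (0 : R)^'+ => e; exists e; split.
    by near: e; exact: nbhs_right_gt.
  by near: e; exact: cov.
by exists e.
Unshelve. all: by end_near.
Qed.

(** * From row vectors to sequences of points *)

Lemma Phi_colloc_det (R : realType) (n : nat) (omega : R -> 'rV[R]_n)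
    (y : nat -> R) :
  Phi omega (\row_(j < n) y j) = colloc_det (fun i t => omega t 0 i) y.
Proof. by congr (\det _); apply/matrixP => i j; rewrite !mxE. Qed.

Lemma det_castmx (R : comPzRingType) (m n : nat) (e : m = n) (A : 'M[R]_m) :
  \det (castmx (e, e) A) = \det A.
Proof. by case: n / e; rewrite castmx_id. Qed.

Lemma Phi_adjoin_colloc_det (R : realType) (n : nat) (omega : R -> 'rV[R]_n)
    (f : R -> R) (y : nat -> R) :
  Phi (adjoin omega f) (\row_(j < n + 1) y j) =
  colloc_det (border (fun i t => omega t 0 i) f) y.
Proof.
(* [adjoin] has size [n + 1] and [border] has size [n.+1]; these are not convertible for variable
   [n], hence the cast. *)
rewrite Phi_colloc_det /colloc_det -(det_castmx (addn1 n)); congr (\det _).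
apply/matrixP => i j; rewrite castmxE mxE [RHS]mxE /border.
case: unliftP => [i' ->|->].
  have -> : cast_ord (esym (addn1 n)) (lift ord_max i') = lshift 1 i'.
    by apply: val_inj; rewrite /= /bump leqNgt ltn_ord.
  by rewrite /adjoin row_mxEl.
have -> : cast_ord (esym (addn1 n)) ord_max = rshift n ord0.
  by apply: val_inj; rewrite /= addn0.
by rewrite /adjoin row_mxEr mxE mulr1n.
Qed.

Theorem corollary12 (R : realType) (I : set R)
    (I_interval : is_interval I)
    (I_nondegenerate : exists a b : R, [/\ I a, I b & a < b])
    (n : nat) (n_gt0 : (0 < n)%N)
    (omega : R -> 'rV[R]_n)
    (omega_Chebyshev : positive_Chebyshev_system I omega)
    (omega_next : R -> R)
    (omega_star_Chebyshev :
       positive_Chebyshev_system I (adjoin omega omega_next))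
    (f : R -> R) :
  omega_convex omega I f <->
  (forall p : R, I p ->
     exists U : set R,
       [/\ U `<=` I, within I (nbhs p) U & omega_convex omega U f]).
Proof.
split=> [f_convex p Ip|f_local x [xI x_incr]].
  by exists I; split=> //; exact: withinT.
pose y j := if insub j is Some i then x 0 i else 0.
have yE (i : 'I_(n + 1)) : y i = x 0 i by rewrite /y valK.
have y_ord j : (j <= n)%N -> exists2 i : 'I_(n + 1), i = j :> nat & y j = x 0 i.
  rewrite -ltnS -[n.+1]addn1 => ltjn; exists (Ordinal ltjn) => //.
  by rewrite -yE.
have y_incr i j : (i < j <= n)%N -> y i < y j.
  move=> /andP[ltij lejn].
  have [i' i'E ->] := y_ord i (ltnW (leq_trans ltij lejn)).
  have [j' j'E ->] := y_ord j lejn.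
  by apply: x_incr; rewrite i'E j'E.
have yI j : (j <= n)%N -> I (y j) by move=> /y_ord[i _ ->].
have itvI t : y 0%N <= t <= y n -> I t.
  exact: (I_interval _ _ (yI _ (leq0n n)) (yI _ (leqnn n))).
have -> : x = \row_(j < n + 1) y j by apply/rowP => j; rewrite mxE yE.
have convexS A B : A `<=` B -> omega_convex omega B f -> omega_convex omega A f.
  by move=> AB fB z [zA z_incr]; apply: fB; split=> // i; exact/AB/zA.
have [e [e_gt0 f_near]] : exists e : R, 0 < e /\ forall t,
    `[y 0%N, y n]%classic t -> omega_convex omega (I `&` `[t, t + e]) f.
  apply: (uniformly_local (P := fun S => omega_convex omega S f)) => //.
  by move=> p /f_local[U [_ IU fU]]; exists U.
have [M [g [M_gt0 g_homo gM g_fine]]] := exists_fine_subdivision y_incr e_gt0.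
have g_mono i j : (i <= j)%N -> g i <= g j by exact: (ltW_homo g_homo).
have g0 : g 0%N = y 0%N by rewrite -gM.
have g_itv p : (p <= n * M)%N -> y 0%N <= g p <= y n.
  by move=> lep; rewrite -g0 -gM // !g_mono.
have gI p : (p <= n * M)%N -> I (g p).
  by move=> /g_itv/itvI.
rewrite Phi_adjoin_colloc_det.
(* The given tuple sits in the subdivision at the multiples of [M]. *)
rewrite (@eq_colloc_det _ _ _ _ _ (g \o muln^~ M)) => [|j ltjn]; last first.
  by rewrite /= gM.
apply: (colloc_det_border_consecutive (N := (n * M)%N)) => //.
- move=> z z_homo z_le; rewrite -Phi_colloc_det; apply: omega_Chebyshev.
  split=> [i|i j ltij]; rewrite !mxE; first by apply/gI/z_le.
  exact/g_homo/z_homo.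
(* By the choice of [M], the points [g p], ..., [g (p + n)] lie in the window [[g p, g p + e]],
   where [f] is [omega]-convex. *)
- move=> p lep; rewrite -Phi_adjoin_colloc_det; apply: (f_near (g p)).
    by rewrite /= in_itv g_itv // (leq_trans (leq_addr n p)).
  split=> [i|i j ltij]; rewrite !mxE; last first.
    by apply: g_homo; rewrite ltn_add2l.
  have lein : (i <= n)%N by rewrite -ltnS -[n.+1]addn1.
  split; first by apply: gI; rewrite (leq_trans _ lep) // leq_add2l.
  rewrite /= in_itv /= g_mono ?leq_addr //=.
  by rewrite (le_trans _ (g_fine p lep)) // g_mono // leq_add2l.
- by move=> i j ltij; rewrite ltn_pmul2r.
Qed.
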